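(* Let $G=(V,E)$ be a simple, connected, undirected graph on $n$ vertices with at least one edge. If $G$ is totally conformally rigid, then $w=\mathbf{1}$ minimizes $\mathrm{Kf}(G,w)$ over all $w\in\Delta_E$.
   Context: $\mathbf{1}\in\mathbb{R}^E$ is all-ones, $\Delta_E=\{w\in\mathbb{R}^E:w\ge0,\ \mathbf{1}^Tw=|E|\}$. For $w\in\mathbb{R}^E$, $\mathcal{L}(w)=\sum_{ab\in E}w_{ab}(e_a-e_b)(e_a-e_b)^T$ with eigenvalues $0=\lambda_1(w)\le\dots\le\lambda_n(w)$; $S_k(w)$, $s_k(w)$ denote the sums of the $k$ largest, resp. $k$ smallest, among $\lambda_2(w),\dots,\lambda_n(w)$. $G$ is totally conformally rigid if for every $k\in\{1,\dots,n-1\}$ and all $w,w'\in\Delta_E$, $s_k(w)\le s_k(\mathbf{1})\le S_k(\mathbf{1})\le S_k(w')$. The Kirchhoff index is $\mathrm{Kf}(G,w)=\sum_{\{a,b\}\subseteq V}(e_a-e_b)^T\mathcal{L}(w)^\dagger(e_a-e_b)$ (sum over unordered pairs of distinct vertices, $\dagger$ the Moore–Penrose pseudoinverse) when the graph with edges of positive weight is connected (i.e. $\lambda_2(w)>0$), and $\mathrm{Kf}(G,w)=\infty$ otherwise. *)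

(* Defs.v *)
From mathcomp Require Import all_boot all_order all_algebra.
From mathcomp Require Import complex.
From mathcomp Require Import boolp classical_sets reals constructive_ereal.

Set Implicit Arguments.
Unset Strict Implicit.
Unset Printing Implicit Defensive.

Import Order.TTheory GRing.Theory Num.Theory.

Local Open Scope ring_scope.

Section Matrices.
Context {R : rcfType}.

(* The eigenvalues of a square matrix whose characteristic polynomial splits
   over R, in nondecreasing order and repeated according to (algebraic)
   multiplicity; [::] is a junk value, which is never reached for symmetric
   matrices by eigsP. *)
Definition is_spectrum n (A : 'M[R]_n) (s : seq R) : Prop :=
  sorted <=%R s /\ char_poly A = \prod_(x <- s) ('X - x%:P).

Definition eigs n (A : 'M[R]_n) : seq R := xget [::] (is_spectrum A).

(* The Moore-Penrose pseudoinverse, as the solution of the four Penrose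
   equations; it exists and is unique by mpinvP and is_mpinv_uniq, so that the
   default value 0 is never used. *)
Definition is_mpinv m n (A : 'M[R]_(m, n)) (X : 'M[R]_(n, m)) : Prop :=
  [/\ A *m X *m A = A,
      X *m A *m X = X,
      (A *m X)^T = A *m X
    & (X *m A)^T = X *m A].

Definition mpinv m n (A : 'M[R]_(m, n)) : 'M[R]_(n, m) :=
  xget 0 (is_mpinv A).

Lemma eigsP n (A : 'M[R]_n) : A^T = A -> is_spectrum A (eigs A).
Proof.
move=> symA; apply: xgetPex.
pose f : {rmorphism R -> R[i]} := real_complex R.
pose B := map_mx f A.
have Breal : B \is a realmx.
  by apply/mxOverP => i j; rewrite mxE; apply/complex_realP; exists (A i j).
have Bherm : B \is hermsymmx.
  apply: realsym_hermsym => //; apply/is_hermitianmxP.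
  by rewrite expr0 scale1r map_mx_id// /B -{1}symA map_trmx.
have /orthomx_spectralP BE := hermitian_normalmx Bherm.
have /mxOverP Dreal := hermitian_spectral_diag_real Bherm.
set P := spectralmx B in BE; set D := spectral_diag B in BE Dreal.
have Punit : P \in unitmx by apply: spectral_unit.
have charB : char_poly B = \prod_i ('X - (D 0 i)%:P).
  rewrite -[RHS](_ : char_poly (diag_mx D) = _); last first.
    rewrite char_poly_trig ?diag_mx_is_trig//.
    by apply: eq_bigr => i _; rewrite mxE eqxx mulr1n.
  rewrite BE /char_poly /char_poly_mx.
  pose Q := map_mx polyC P; pose Q' := map_mx polyC (invmx P).
  have QQ : Q' *m Q = 1%:M by rewrite -map_mxM mulVmx// map_mx1.
  have -> : 'X%:M - map_mx polyC (invmx P *m diag_mx D *m P) =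
            Q' *m ('X%:M - map_mx polyC (diag_mx D)) *m Q.
    rewrite mulmxBr mulmxBl !map_mxM; congr (_ - _).
    by rewrite scalar_mxC -mulmxA QQ mulmx1.
  by rewrite !det_mulmx mulrAC -det_mulmx QQ det1 mul1r.
pose s := [seq complex.Re (D 0 i) | i <- enum 'I_n].
exists (sort <=%R s); split; first exact/sort_sorted/le_total.
apply: (map_inj_poly (fmorph_inj f) (rmorph0 f)).
rewrite map_char_poly -/B charB rmorph_prod.
rewrite (perm_big s) /=; last by rewrite perm_sort.
rewrite big_map big_enum /=; apply: eq_bigr => i _.
rewrite rmorphB /= map_polyX map_polyC /=; congr (_ - _%:P).
by rewrite /f /= RRe_real// Dreal.
Qed.

Lemma is_mpinv_uniq m n (A : 'M[R]_(m, n)) X Y :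
  is_mpinv A X -> is_mpinv A Y -> X = Y.
Proof.
move=> [X1 X2 X3 X4] [Y1 Y2 Y3 Y4].
have AXY : A *m X = A *m Y.
  rewrite -X3 -[A in (A *m X)^T]Y1 -!mulmxA mulmxA trmx_mul X3 Y3.
  by rewrite mulmxA X1.
have XYA : X *m A = Y *m A.
  rewrite -X4 -[A in (X *m A)^T]Y1 -mulmxA mulmxA trmx_mul X4 Y4.
  by rewrite -mulmxA [A *m _]mulmxA X1.
by rewrite -X2 -mulmxA AXY mulmxA XYA Y2.
Qed.

Lemma gram_unit m n (C : 'M[R]_(m, n)) : row_free C -> C *m C^T \in unitmx.
Proof.
move=> Cfree; rewrite -row_free_unit -kermx_eq0; apply/rowV0P => v.
move=> /sub_kermxP vC; apply/eqP.
rewrite -(mulmx_free_eq0 _ Cfree).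
set u := v *m C.
have /matrixP/(_ 0 0) : u *m u^T = 0.
  by rewrite trmx_mul mulmxA -(mulmxA v) vC mul0mx.
have -> : (u *m u^T) 0 0 = \sum_i u 0 i ^+ 2.
  by rewrite mxE; apply: eq_bigr => i _; rewrite [u^T _ _]mxE -expr2.
rewrite mxE => /psumr_eq0P u0; apply/eqP/rowP => i; rewrite [RHS]mxE.
by apply/eqP; rewrite -sqrf_eq0 u0// => j _; apply: sqr_ge0.
Qed.

Lemma mpinv_full_rank m n r (B : 'M[R]_(m, r)) (C : 'M[R]_(r, n)) :
    row_full B -> row_free C ->
  is_mpinv (B *m C)
    (C^T *m invmx (C *m C^T) *m (invmx (B^T *m B) *m B^T)).
Proof.
move=> Bfull /gram_unit CU.
have BU : B^T *m B \in unitmx.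
  by rewrite -{2}[B]trmxK; apply: gram_unit; rewrite /row_free mxrank_tr.
have CK : C *m C^T *m invmx (C *m C^T) = 1%:M by rewrite mulmxV.
have BK : invmx (B^T *m B) *m (B^T *m B) = 1%:M by rewrite mulVmx.
set X := _ *m (_ *m _).
have AX : B *m C *m X = B *m invmx (B^T *m B) *m B^T.
  by rewrite /X !mulmxA -(mulmxA B C) -(mulmxA B (C *m _)) CK mulmx1.
have XA : X *m (B *m C) = C^T *m invmx (C *m C^T) *m C.
  rewrite /X -!mulmxA; do 2 congr (_ *m _).
  by rewrite !mulmxA -(mulmxA (invmx _)) BK mul1mx.
split.
- by rewrite AX !mulmxA -(mulmxA _ B^T) -(mulmxA B) BK mulmx1.
- rewrite XA /X !mulmxA; congr (_ *m _ *m _).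
  by rewrite -(mulmxA _ C) -(mulmxA (_ *m _) (C *m _)) CK mulmx1.
- by rewrite AX !trmx_mul trmxK trmx_inv trmx_mul trmxK mulmxA.
- by rewrite XA !trmx_mul trmxK trmx_inv trmx_mul trmxK mulmxA.
Qed.

Lemma mpinvP m n (A : 'M[R]_(m, n)) : is_mpinv A (mpinv A).
Proof.
apply: xgetPex; have := mpinv_full_rank (col_base_full A) (row_base_free A).
by rewrite mulmx_base => AX; eexists; exact: AX.
Qed.

End Matrices.

(* A graph on the finite type V is given by its set E of edges, an edge joining
   a and b being the two-element set [set a; b]. *)
Definition simple_graph (V : finType) (E : {set {set V}}) : bool :=
  [forall f in E, #|f| == 2].

Definition connected_rel (V : finType) (r : rel V) : bool :=
  [forall a, forall b, connect r a b].

Definition adj (V : finType) (E : {set {set V}}) : rel V :=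
  [rel a b | [set a; b] \in E].

(* R^E *)
Notation weights R E := {ffun {f | f \in E} -> R}.

Section WeightedGraphs.
Context {R : realType} {V : finType} {E : {set {set V}}}.
Implicit Types w : weights R E.

Definition ones : weights R E := [ffun=> 1].

Definition Delta w : Prop :=
  (forall f, 0 <= w f) /\ \sum_f w f = #|E|%:R.

(* w_ab, with value 0 when ab is not an edge *)
Definition wt w (a b : V) : R :=
  if insub [set a; b] is Some f then w f else 0.

Definition evec (a : V) : 'cV[R]_#|V| := delta_mx (enum_rank a) 0.

(* The condition enum_rank a < enum_rank b makes (a, b) range over the
   unordered pairs of distinct vertices, each taken once; the same device is
   used in Kf. *)
Definition laplacian w : 'M[R]_#|V| :=
  \sum_a \sum_(b | (enum_rank a < enum_rank b)%N)
    wt w a b *: ((evec a - evec b) *m (evec a - evec b)^T).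

Lemma laplacian_sym w : (laplacian w)^T = laplacian w.
Proof.
rewrite /laplacian !raddf_sum; apply: eq_bigr => a _.
rewrite raddf_sum; apply: eq_bigr => b _.
by rewrite /= linearZ /= trmx_mul trmxK.
Qed.

(* lambda_i(w), for 1 <= i <= n *)
Definition lambda w (i : nat) : R := nth 0 (eigs (laplacian w)) i.-1.

Definition sum_smallest w (k : nat) : R := \sum_(2 <= i < k.+2) lambda w i.

Definition sum_largest w (k : nat) : R :=
  \sum_(#|V| - k + 1 <= i < #|V|.+1) lambda w i.

Local Open Scope ereal_scope.

Definition Kf w : \bar R :=
  if connected_rel [rel a b | 0 < wt w a b]%R then
    (\sum_a \sum_(b | (enum_rank a < enum_rank b)%N)
      ((evec a - evec b)^T *m mpinv (laplacian w) *m (evec a - evec b)) 0 0)%R%:E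
  else +oo.

End WeightedGraphs.

Arguments ones : clear implicits.

Definition totally_conformally_rigid (R : realType) (V : finType)
    (E : {set {set V}}) : Prop :=
  forall k : nat, (1 <= k <= #|V| - 1)%N ->
  forall w w' : weights R E, Delta w -> Delta w' ->
  sum_smallest w k <= sum_smallest (ones R V E) k
    <= sum_largest (ones R V E) k
  /\ sum_largest (ones R V E) k <= sum_largest w' k.

(* Main.v *)
(** The identity [Kf w = n * sum_(i >= 2) 1 / lambda_i(w)] reduces the
    claim to an inequality between spectra: the bounds [s_k(w) <= s_k(1)] say
    that the partial sums of the nonzero spectrum of [w] lie below those of
    [1], so sums of the decreasing convex function [1/x] compare the other way.
    The latter follows from the tangent line of [1/x] at [lambda_i(1)] and Abel
    summation, as the slopes [lambda_i(1)^-2] decrease in [i]. *)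

Require Import Defs.
From mathcomp Require Import all_boot all_order all_algebra.
From mathcomp Require Import complex ring.
From mathcomp Require Import reals constructive_ereal.

Import Order.TTheory GRing.Theory Num.Theory.

Local Open Scope ring_scope.

(** * Inequalities for sums of reciprocals *)

Lemma abel_sum_ge0 (R : realFieldType) (m : nat) (c d : nat -> R) :
    (forall i, (i < m)%N -> 0 <= c i) ->
    (forall i, (i.+1 < m)%N -> c i.+1 <= c i) ->
    (forall k, (k <= m)%N -> 0 <= \sum_(0 <= i < k) d i) ->
  0 <= \sum_(0 <= i < m) c i * d i.
Proof.
case: m => [|m] c0 cdec d0; first by rewrite big_geq.
(* Abel summation as an induction: lowering [c k] to [c k.+1] in front of a nonnegative partial sum
   of [d] can only decrease the left side. *)
suff H k : (k <= m)%N ->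
    c k * \sum_(0 <= i < k.+1) d i <= \sum_(0 <= i < k.+1) c i * d i.
  by apply: le_trans (H m _); rewrite ?mulr_ge0 ?c0 ?d0.
elim: k => [|k IHk] km; first by rewrite !big_nat1.
rewrite big_nat_recr //= [leRHS]big_nat_recr //= mulrDr lerD2r.
by apply: le_trans (IHk (ltnW km)); rewrite ler_wpM2r ?cdec ?d0 // ltnW.
Qed.

(** Convexity of the reciprocal, with the tangent taken at [y]: the gap between the two sides is
    [(x - y)^2 / (x y^2)]. *)
Lemma inv_tangent_line (R : realFieldType) (x y : R) :
  0 < x -> 0 < y -> y^-1 ^+ 2 * (y - x) <= x^-1 - y^-1.
Proof.
move=> x0 y0; rewrite -subr_ge0.
have -> : x^-1 - y^-1 - y^-1 ^+ 2 * (y - x) = (x - y) ^+ 2 * x^-1 * y^-1 ^+ 2.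
  by field; rewrite !gt_eqF.
by apply/mulr_ge0/sqr_ge0/mulr_ge0; rewrite ?sqr_ge0 // invr_ge0 ltW.
Qed.

Lemma weak_majorization_sum_inv (R : realFieldType) (m : nat) (x y : nat -> R) :
    (forall i, (i < m)%N -> 0 < x i) -> (forall i, (i < m)%N -> 0 < y i) ->
    (forall i, (i.+1 < m)%N -> y i <= y i.+1) ->
    (forall k, (k <= m)%N -> \sum_(0 <= i < k) x i <= \sum_(0 <= i < k) y i) ->
  \sum_(0 <= i < m) (y i)^-1 <= \sum_(0 <= i < m) (x i)^-1.
Proof.
move=> x0 y0 ymon le_xy; rewrite -subr_ge0 -sumrB.
apply: (@le_trans _ _ (\sum_(0 <= i < m) (y i)^-1 ^+ 2 * (y i - x i))).
  apply: abel_sum_ge0 => [i _|i im|k km]; first exact: sqr_ge0.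
  - have [yi yi1] := (y0 _ (ltnW im), y0 _ im).
    by rewrite ler_pXn2r ?nnegrE ?invr_ge0 ?lef_pV2 ?ymon // ltW.
  - by rewrite sumrB subr_ge0 le_xy.
by apply: ler_sum_nat => i /andP[_ im]; apply: inv_tangent_line; auto.
Qed.

(** * Spectra of symmetric matrices and their pseudoinverses *)

Lemma symmetric_diagonalization {R : rcfType} {n : nat} {A : 'M[R]_n} :
    A^T = A ->
  exists P : 'M[R[i]]_n, exists D : 'rV[R]_n,
    [/\ P \in unitmx,
        P *m map_mx (real_complex R) A *m invmx P =
          diag_mx (map_mx (real_complex R) D)
      & perm_eq (eigs A) [seq D 0 i | i <- enum 'I_n]].
Proof.
move=> symA; have [_ charA] := eigsP symA.
pose f : {rmorphism R -> R[i]} := real_complex R.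
(* The spectral theorem is applied to [A] seen as a Hermitian matrix over [R[i]]; its eigenvalues
   are real, so the diagonal descends to [D'] over [R]. *)
pose B := map_mx f A.
have Breal : B \is a realmx.
  by apply/mxOverP => i j; rewrite mxE; apply/complex_realP; exists (A i j).
have Bherm : B \is hermsymmx.
  apply: realsym_hermsym => //; apply/is_hermitianmxP.
  by rewrite expr0 scale1r map_mx_id// /B -{1}symA map_trmx.
have /orthomx_spectralP BE := hermitian_normalmx Bherm.
have /mxOverP Dreal := hermitian_spectral_diag_real Bherm.
set P := spectralmx B in BE; set D := spectral_diag B in BE Dreal.
have Punit : P \in unitmx by apply: spectral_unit.
pose D' : 'rV[R]_n := \row_i complex.Re (D 0 i).
have fD' : map_mx f D' = D.
  by apply/rowP => i; rewrite !mxE /f /= RRe_real // Dreal.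
have PBP : P *m B *m invmx P = diag_mx (map_mx f D').
  by rewrite fD' BE !mulmxA mulmxV // mul1mx mulmxK.
exists P, D'; split => //.
(* Similarity preserves the characteristic polynomial, whose linear factors determine [eigs A] up to
   order. *)
have charB : char_poly B = char_poly (diag_mx D).
  rewrite -fD' -PBP /char_poly /char_poly_mx.
  pose Q := map_mx polyC P; pose Q' := map_mx polyC (invmx P).
  have QQ : Q *m Q' = 1%:M by rewrite -map_mxM mulmxV// map_mx1.
  have -> : 'X%:M - map_mx polyC (P *m B *m invmx P) =
            Q *m ('X%:M - map_mx polyC B) *m Q'.
    rewrite mulmxBr mulmxBl !map_mxM; congr (_ - _).
    by rewrite scalar_mxC -mulmxA QQ mulmx1.
  by rewrite !det_mulmx mulrAC -det_mulmx QQ det1 mul1r.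
apply: prod_XsubC_eq; rewrite -charA.
apply: (map_inj_poly (fmorph_inj f) (rmorph0 f)).
rewrite map_char_poly -/B charB char_poly_trig ?diag_mx_is_trig//.
rewrite big_map big_enum /= rmorph_prod; apply: eq_bigr => i _.
rewrite -fD' !mxE eqxx mulr1n rmorphB /= map_polyX map_polyC /=.
by rewrite -/f.
Qed.

(** For symmetric [A], transposition permutes the Penrose equations, so uniqueness of the solution
    applies. *)
Lemma mpinv_sym {R : rcfType} {n : nat} {A : 'M[R]_n} :
  A^T = A -> (mpinv A)^T = mpinv A.
Proof.
move=> symA; have [X1 X2 X3 X4] := mpinvP A.
apply: (@is_mpinv_uniq _ _ _ A); last exact: mpinvP.
split; last 2 first.
- by rewrite trmx_mul trmxK symA -X4 trmx_mul symA.
- by rewrite trmx_mul trmxK symA -X3 trmx_mul symA.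
- by apply: trmx_inj; rewrite !trmx_mul trmxK symA mulmxA X1.
- by apply: trmx_inj; rewrite !trmx_mul trmxK symA mulmxA X2.
Qed.

Lemma mpinv_comm {R : rcfType} {n : nat} {A : 'M[R]_n} :
  A^T = A -> A *m mpinv A = mpinv A *m A.
Proof.
move=> symA; have [_ _ X3 _] := mpinvP A.
by rewrite -X3 trmx_mul mpinv_sym // symA.
Qed.

(* In a basis diagonalizing [A], the Penrose equations and commutation force the
   diagonal entries of [mpinv A] to be the inverses of those of [A]; here
   [0^-1 = 0], so that zero eigenvalues contribute nothing to either sum. *)
Lemma eigs_mpinv {R : rcfType} {n : nat} {A : 'M[R]_n} : A^T = A ->
  \tr (mpinv A) = \sum_(x <- eigs A) x^-1 /\
  \tr (A *m mpinv A) = \sum_(x <- eigs A) x * x^-1.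
Proof.
move=> symA; have [P [D [Punit PAP eigD]]] := symmetric_diagonalization symA.
pose f : {rmorphism R -> R[i]} := real_complex R.
have [X1 X2 _ _] := mpinvP A; have XC := mpinv_comm symA.
set X := mpinv A in X1 X2 XC *.
pose conj (M : 'M[R]_n) := P *m map_mx f M *m invmx P.
have conjM M N : conj (M *m N) = conj M *m conj N.
  by rewrite /conj map_mxM !mulmxA mulmxKV.
have tr_conj M : \tr (conj M) = f (\tr M).
  by rewrite /conj mxtrace_mulC mulmxA mulVmx // mul1mx -trace_map_mx.
have conjA : conj A = diag_mx (map_mx f D) by [].
pose Y := conj X; pose d i := f (D 0 i).
have DY i j : (conj A *m Y) i j = d i * Y i j.
  by rewrite conjA mul_diag_mx !mxE.
have YD i j (M : 'M_n) : (M *m conj A) i j = M i j * d j.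
  by rewrite conjA mul_mx_diag !mxE.
have Yii i : Y i i = (d i)^-1.
  (* If [d i = 0], writing [X] as [X *m X *m A] exhibits a factor [d i] in the entry; otherwise
     [A *m X *m A = A] reads [d i * Y i i * d i = d i]. *)
  have [di0|di0] := eqVneq (d i) 0.
    rewrite di0 invr0 /Y -X2 -mulmxA XC mulmxA conjM YD di0 mulr0 //.
  have : (conj A *m Y *m conj A) i i = (conj A) i i by rewrite -!conjM X1.
  rewrite YD DY conjA !mxE eqxx mulr1n -/(d i) => e.
  by apply: (mulfI di0); apply: (mulIf di0); rewrite e mulfV // mul1r.
split; apply: (fmorph_inj f).
- rewrite -tr_conj rmorph_sum (perm_big _ eigD) big_map big_enum /=.
  by apply: eq_bigr => i _; rewrite -/Y Yii /d -fmorphV.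
- rewrite -tr_conj rmorph_sum (perm_big _ eigD) big_map big_enum /=.
  by apply: eq_bigr => i _; rewrite conjM DY Yii /d -fmorphV -rmorphM.
Qed.

Lemma size_eigs {R : rcfType} {n : nat} {A : 'M[R]_n} :
  A^T = A -> size (eigs A) = n.
Proof.
move=> /eigsP[_ charA]; have := size_prod_XsubC (eigs A) id.
by rewrite -charA size_char_poly => -[].
Qed.

(** At a row eigenvector [v] the quadratic form equals [x] times the positive number [v *m v^T]. *)
Lemma eigs_ge0 {R : rcfType} {n : nat} {A : 'M[R]_n} (x : R) : A^T = A ->
  (forall v : 'rV_n, 0 <= (v *m A *m v^T) 0 0) -> x \in eigs A -> 0 <= x.
Proof.
move=> /eigsP[_ charA] psdA xA.
have : root (char_poly A) x by rewrite charA root_prod_XsubC.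
rewrite -eigenvalue_root_char => /eigenvalueP[v vA v0].
have := psdA v; rewrite vA -scalemxAl mxE.
have vv : 0 < (v *m v^T) 0 0.
  rewrite mxE lt0r sumr_ge0 => [|i _]; last by rewrite mxE -expr2 sqr_ge0.
  rewrite andbT; apply: contraNneq v0 => /psumr_eq0P v0; apply/eqP/rowP => i.
  apply/eqP; rewrite [X in _ == X]mxE -sqrf_eq0 expr2.
  by have := v0 _ i isT; rewrite [v^T _ _]mxE => ->// j _; rewrite mxE -expr2 sqr_ge0.
by rewrite pmulr_lge0.
Qed.

(** As [0^-1 = 0], each term is 0 or 1. This turns the trace of [A *m mpinv A] into the number of
    nonzero eigenvalues. *)
Lemma sum_mulfV (F : fieldType) (s : seq F) :
  \sum_(x <- s) x * x^-1 = (count (predC1 0) s)%:R.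
Proof.
elim: s => [|x s IHs]; rewrite ?big_nil // big_cons IHs /= natrD.
by have [->|x0] := eqVneq x 0; rewrite ?mul0r ?mulfV.
Qed.

Lemma sorted_nonneg_count0 {R : realDomainType} {s : seq R} :
    sorted <=%R s -> {in s, forall x, 0 <= x} -> count_mem 0 s = 1%N ->
  exists2 t, s = 0 :: t & {in t, forall x, 0 < x}.
Proof.
case: s => [//|x s] /= sorts s0.
have [-> [/count_memPn s0'] | x0] := eqVneq x 0.
  exists s => // y ys; rewrite lt0r s0 ?inE ?ys ?orbT // andbT.
  by apply: contraNneq s0' => <-.
(* A positive head of a sorted list leaves no room for 0, contradicting the count. *)
have {}x0 : 0 < x by rewrite lt0r x0 s0 ?mem_head.
rewrite add0n; suff /count_memPn -> : 0 \notin s by [].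
apply/negP => /(allP (order_path_min le_trans sorts)).
by rewrite leNgt x0.
Qed.

(** The diagonal vanishes and, by symmetry, the pairs on either side of it contribute equally. This
    frees the sum in [Kf] from its rank condition. *)
Lemma sum_unordered_pairs (V : finType) (M : nmodType) (f : V -> V -> M) :
    (forall a b, f a b = f b a) -> (forall a, f a a = 0) ->
  \sum_a \sum_b f a b =
  (\sum_a \sum_(b | (enum_rank a < enum_rank b)%N) f a b) *+ 2.
Proof.
move=> fC f0; rewrite mulr2n [X in _ = _ + X](exchange_big_dep xpredT) //=.
rewrite -big_split; apply: eq_bigr => a _ /=.
rewrite (bigID (fun b => (enum_rank a < enum_rank b)%N)) /=; congr (_ + _).
rewrite (bigD1 a) ?ltnn //= f0 add0r; apply: eq_big => // b.
rewrite -leqNgt ltn_neqAle andbC; congr (_ && _).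
by rewrite (inj_eq val_inj) (inj_eq enum_rank_inj).
Qed.

(** * Weighted Laplacians and the Kirchhoff index *)

Section Laplacian.
Context {R : realType} {V : finType} {E : {set {set V}}}.
Implicit Type w : weights R E.

Local Notation rk := enum_rank.

Lemma mul_evecB (m : nat) (M : 'M[R]_(m, #|V|)) a b i j :
  (M *m (evec a - evec b)) i j = M i (rk a) - M i (rk b).
Proof. by rewrite mulmxBr -!colE !mxE. Qed.

Lemma evecB_mul (m : nat) (M : 'M[R]_(#|V|, m)) a b i j :
  ((evec a - evec b)^T *m M) i j = M (rk a) j - M (rk b) j.
Proof.
by rewrite -[M]trmxK -trmx_mul mxE mul_evecB !mxE. Qed.

Lemma wtC w a b : wt w a b = wt w b a.
Proof. by rewrite /wt setUC. Qed.

Lemma wt_ge0 w a b : (forall f, 0 <= w f) -> 0 <= wt w a b.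
Proof. by rewrite /wt; case: insubP. Qed.

Lemma laplacian_form w (v : 'cV[R]_#|V|) :
  (v^T *m laplacian w *m v) 0 0 =
  \sum_a \sum_(b | (rk a < rk b)%N) wt w a b * (v (rk a) 0 - v (rk b) 0) ^+ 2.
Proof.
rewrite mulmx_sumr mulmx_suml summxE; apply: eq_bigr => a _.
rewrite mulmx_sumr mulmx_suml summxE; apply: eq_bigr => b _.
rewrite -scalemxAr -scalemxAl mxE; congr (_ * _).
by rewrite (mulmxA v^T) -mulmxA mxE big_ord1 mul_evecB evecB_mul !mxE expr2.
Qed.

Lemma laplacian_const w : laplacian w *m (const_mx 1 : 'cV_#|V|) = 0.
Proof.
rewrite mulmx_suml big1 // => a _; rewrite mulmx_suml big1 // => b _.
rewrite -scalemxAl -mulmxA; suff -> : (evec a - evec b)^T *m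
  (const_mx 1 : 'cV[R]_#|V|) = 0 by rewrite mulmx0 scaler0.
by apply/matrixP => i j; rewrite evecB_mul !mxE subrr.
Qed.

Lemma laplacian_psd w (v : 'rV[R]_#|V|) : (forall f, 0 <= w f) ->
  0 <= (v *m laplacian w *m v^T) 0 0.
Proof.
move=> w0; rewrite -{1}[v]trmxK laplacian_form.
by do 2![apply: sumr_ge0 => *]; rewrite mulr_ge0 ?wt_ge0 ?sqr_ge0.
Qed.

(** The form [v^T L v] vanishes and is a sum of nonnegative terms, so [v] agrees at the ends of each
    edge of positive weight, hence along paths of such edges. *)
Lemma laplacian_ker w (v : 'cV[R]_#|V|) : (forall f, 0 <= w f) ->
    connected_rel [rel a b | 0 < wt w a b] -> laplacian w *m v = 0 ->
  forall i j, v i 0 = v j 0.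
Proof.
move=> w0 conn Lv0.
have term0 a b : 0 <= wt w a b * (v (rk a) 0 - v (rk b) 0) ^+ 2.
  by rewrite mulr_ge0 ?wt_ge0 ?sqr_ge0.
have := laplacian_form w v; rewrite -mulmxA Lv0 mulmx0 mxE => /esym form0.
have edge_lt a b : (rk a < rk b)%N -> 0 < wt w a b -> v (rk a) 0 = v (rk b) 0.
  move=> ab wab.
  have inner_ge0 c : true -> 0 <= \sum_(d | (rk c < rk d)%N)
      wt w c d * (v (rk c) 0 - v (rk d) 0) ^+ 2.
    by move=> _; apply: sumr_ge0.
  have inner0 := @psumr_eq0P _ _ _ _ inner_ge0 form0 a isT.
  have /eqP := @psumr_eq0P _ _ _ _ (fun d _ => term0 a d) inner0 b ab.
  by rewrite mulf_eq0 gt_eqF //= sqrf_eq0 subr_eq0 => /eqP.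
have edge_eq a b : 0 < wt w a b -> v (rk a) 0 = v (rk b) 0.
  have [ab|ba|/val_inj/enum_rank_inj -> //] := ltngtP (rk a) (rk b).
    exact: edge_lt.
  by rewrite wtC => wba; apply/esym/edge_lt.
have path_eq a b : connect [rel a b | 0 < wt w a b] a b ->
    v (rk a) 0 = v (rk b) 0.
  move=> /connectP[p]; elim: p a => [|c p IHp] a /=; first by move=> _ ->.
  by move=> /andP[/edge_eq -> cp] /(IHp _ cp).
move=> i j; rewrite -(enum_valK i) -(enum_valK j); apply: path_eq.
by move/forallP/(_ (enum_val i))/forallP: conn; apply.
Qed.

(* [1 - mpinv L *m L] projects onto the constants, so it has trace 1; its trace
   also counts the zero eigenvalues of [L]. *)
Lemma laplacian_count0 w : (0 < #|V|)%N -> (forall f, 0 <= w f) ->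
    connected_rel [rel a b | 0 < wt w a b] ->
  count_mem 0 (eigs (laplacian w)) = 1%N.
Proof.
move=> V0 w0 conn; set L := laplacian w.
have symL : L^T = L by apply: laplacian_sym.
have [L1 _ _ _] := mpinvP L; have XC := mpinv_comm symL.
pose N := 1%:M - mpinv L *m L.
have LN : L *m N = 0 by rewrite mulmxBr mulmx1 mulmxA L1 subrr.
have N1 : N *m (const_mx 1 : 'cV_#|V|) = const_mx 1.
  by rewrite mulmxBl mul1mx -mulmxA laplacian_const mulmx0 subr0.
have Ncol i j k : N i k = N j k.
  have := @laplacian_ker w (col k N) w0 conn _ i j; rewrite !mxE.
  by apply; rewrite colE mulmxA LN mul0mx.
(* Each column of [N] is constant, so the trace equals the sum of any row, which is 1 by [N1]. *)
have trN : \tr N = 1.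
  pose i0 := Ordinal V0; have /matrixP/(_ i0 0) := N1; rewrite !mxE => <-.
  by apply: eq_bigr => i _; rewrite [const_mx _ _ _]mxE mulr1 (Ncol i i0).
have [_ trLX] := eigs_mpinv symL.
have := count_predC (pred1 0) (eigs L); rewrite (size_eigs symL) => cnt.
apply/eqP; rewrite -(eqn_add2r (count (predC1 0) (eigs L))) cnt.
rewrite -(eqr_nat R) natrD -sum_mulfV -trLX XC.
by rewrite -[X in X + _]trN raddfB /= mxtrace1 subrK.
Qed.

Lemma laplacian_spectrum w : (0 < #|V|)%N -> (forall f, 0 <= w f) ->
    connected_rel [rel a b | 0 < wt w a b] ->
  exists2 t, eigs (laplacian w) = 0 :: t & {in t, forall x, 0 < x}.
Proof.
move=> V0 w0 conn; have symL := laplacian_sym w.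
apply: sorted_nonneg_count0; last exact: laplacian_count0.
  by have [] := eigsP symL.
by move=> x; apply: eigs_ge0 => // v; apply: laplacian_psd.
Qed.

(** With [X = mpinv L], a pair contributes [X_aa - 2 X_ab + X_bb]. The rows of [X] sum to 0, so
    summing over ordered pairs gives [2 n tr X], and [tr X] is the sum of the inverse eigenvalues,
    the eigenvalue 0 contributing [0^-1 = 0]. *)
Lemma Kf_eigs w : connected_rel [rel a b | 0 < wt w a b] ->
  Kf w = (#|V|%:R * \sum_(x <- eigs (laplacian w)) x^-1)%:E.
Proof.
rewrite /Kf => ->; congr (_%:E).
set L := laplacian w; have symL : L^T = L by apply: laplacian_sym.
have [_ X2 _ _] := mpinvP L; have XC := mpinv_comm symL.
have XT := mpinv_sym symL.
rewrite -(eigs_mpinv symL).1; set X := mpinv L in X2 XC XT *.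
have X1 : X *m (const_mx 1 : 'cV_#|V|) = 0.
  by rewrite -X2 -(mulmxA X) XC -!mulmxA laplacian_const !mulmx0.
have Xsym i j : X i j = X j i by rewrite -[in LHS]XT mxE.
have Xrow i : \sum_j X i j = 0.
  have /matrixP/(_ i 0) := X1; rewrite !mxE => X1i; rewrite -[RHS]X1i.
  by apply: eq_bigr => j _; rewrite mxE mulr1.
pose f a b := X (rk a) (rk a) - X (rk a) (rk b) - (X (rk a) (rk b) - X (rk b) (rk b)).
have -> : \sum_a \sum_(b | (rk a < rk b)%N)
    ((evec a - evec b)^T *m X *m (evec a - evec b)) 0 0 =
    \sum_a \sum_(b | (rk a < rk b)%N) f a b.
  apply: eq_bigr => a _; apply: eq_bigr => b _.
  by rewrite mul_evecB !evecB_mul /f (Xsym (rk b) (rk a)).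
have sum_rk (F : 'I_#|V| -> R) : \sum_a F (rk a) = \sum_i F i.
  by rewrite [RHS](reindex _ (onW_bij _ (enum_rank_bij V))).
have trX : \sum_a X (rk a) (rk a) = \tr X by rewrite (sum_rk (fun i => X i i)).
have rowX a : \sum_b X (rk a) (rk b) = 0 by rewrite sum_rk Xrow.
(* Doubling passes from unordered to ordered pairs. *)
apply: (@mulIf R 2%:R); first by rewrite pnatr_eq0.
rewrite [LHS]mulr_natr -sum_unordered_pairs /f; last 2 first.
- by move=> a b; rewrite (Xsym (rk b)); ring.
- by move=> a; ring.
under eq_bigr => a _ do rewrite !sumrB rowX trX sumr_const subr0 sub0r opprK.
rewrite big_split /= sumr_const sumrMnl trX -mulr_natl. ring.
Qed.

End Laplacian.

(** * The all-ones weighting and the comparison of spectra *)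

Lemma Delta_ones (R : realType) (V : finType) (E : {set {set V}}) :
  Delta (ones R V E).
Proof.
split=> [f|]; first by rewrite ffunE.
under eq_bigr do rewrite ffunE.
by rewrite sumr_const card_sig; congr (_%:R); apply: eq_card => f; rewrite inE.
Qed.

Lemma connected_ones (R : realType) (V : finType) (E : {set {set V}}) :
  connected_rel (adj E) -> connected_rel [rel a b | 0 < wt (ones R V E) a b].
Proof.
move=> conn; apply/forallP => a; apply/forallP => b.
have /forallP/(_ a)/forallP/(_ b) := conn; apply: connect_sub => c d /= cd.
by apply: connect1; rewrite /= /wt insubT ffunE ltr01.
Qed.

Theorem mainTheorem19 (R : realType) (V : finType) (E : {set {set V}})
    (simpleG : simple_graph E) (connectedG : connected_rel (adj E))
    (edgeG : E != set0)
    (rigidG : totally_conformally_rigid R E) :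
  Delta (ones R V E) /\
  forall w : weights R E, Delta w -> (Kf (ones R V E) <= Kf w)%E.
Proof.
have D1 := Delta_ones R V E; split=> // w Dw.
have conn1 := connected_ones R V E connectedG.
have [conn|disc] := boolP (connected_rel [rel a b | 0 < wt w a b]); last first.
  by rewrite [leRHS]/Kf (negPf disc) leey.
have V0 : (0 < #|V|)%N.
  have /set0Pn[e eE] := edgeG.
  have /forallP/(_ e)/implyP/(_ eE)/eqP e2 := simpleG.
  by apply: leq_trans (max_card e); rewrite e2.
rewrite !Kf_eigs // lee_fin ler_wpM2l ?ler0n //.
(* The tail [t] lists [lambda_2, ..., lambda_n], so [lambda u i] is entry [i - 2] of [t] and
   [sum_smallest u k] is an initial partial sum of [t]. *)
have spec (u : weights R E) : Delta u -> connected_rel [rel a b | 0 < wt u a b] ->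
    exists2 t, eigs (laplacian u) = 0 :: t &
      [/\ {in t, forall x, 0 < x}, size t = #|V|.-1, sorted <=%R t &
          forall k, sum_smallest u k = \sum_(0 <= i < k) t`_i].
  move=> [u0 _] connu.
  have [t eigt t0] := laplacian_spectrum u V0 u0 connu.
  have symL := laplacian_sym u; exists t => //; split=> //.
  - by rewrite -(size_eigs symL) eigt.
  - by have [] := eigsP symL; rewrite eigt => /path_sorted.
  - move=> k; rewrite /sum_smallest !big_add1 /=.
    by apply: eq_bigr => i _; rewrite /lambda eigt.
have [t1 -> [t1_gt0 sz1 sort1 sum1]] := spec _ D1 conn1.
have [t -> [t_gt0 sz _ sumt]] := spec _ Dw conn.
(* The eigenvalue 0 gives the same term [0^-1] on both sides, which cancels. *)
rewrite !big_cons lerD2l [leLHS](big_nth 0) [leRHS](big_nth 0) sz sz1.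
apply: weak_majorization_sum_inv => [i im|i im|i im|k km].
- by rewrite t_gt0 // mem_nth // sz.
- by rewrite t1_gt0 // mem_nth // sz1.
- by apply: (sorted_ltn_nth le_trans); rewrite ?inE ?sz1 // ltnW.
(* Rigidity starts at [k = 1]; for [k = 0] both sums are empty. *)
- case: k km => [|k km]; first by rewrite !big_geq.
  rewrite -sumt -sum1; have [|/andP[]//] := rigidG k.+1 _ w w Dw Dw.
  by rewrite subn1.
Qed.
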